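(* Let $\mathsf{C}$ be a strict braided monoidal category, let $\mathbb{H}=(H_1,H_2,\sigma_H)$ be a Hopf truss in $\mathsf{C}$ and let $\mathsf{E}(\mathbb{H})=(id_H:H_2\to H_1,\sigma_H)$ be the associated generalized invertible 1-cocycle, with $\theta_{id_H}=\sigma_H$ and with action $\Gamma_{H_1}^{\sigma_H}=\mu_H^1\circ((\lambda_H\circ\sigma_H)\otimes\mu_H^2)\circ(\delta_H\otimes H)$ of $H_2$ on $H_1$. There exists a functor $$\mathsf{G}_{\mathbb{H}}:{}_{\mathbb{H}}\mathsf{Mod}\to{}_{(id_H,\Gamma_{H_1}^{\sigma_H},\sigma_H)}\mathsf{Mod}$$ defined on objects by $$\mathsf{G}_{\mathbb{H}}((M,\psi_M^1,\psi_M^2))=(M,M,\ \widehat{\phi}_M=\Gamma_M^{\sigma_H},\ \widehat{\varphi}_M=\psi_M^1,\ \overline{\phi}_M=\psi_M^2,\ id_M),$$ where $\Gamma_M^{\sigma_H}=\psi_M^1\circ((\lambda_H\circ\sigma_H)\otimes\psi_M^2)\circ(\delta_H\otimes M)$, and on morphisms by $\mathsf{G}_{\mathbb{H}}(f)=(f,f)$.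
   Context: **Conventions.** $(\mathsf{C},\otimes,K,c)$ is a strict braided monoidal category with unit object $K$ and braiding $c$. For an object $P$ and a morphism $f$, $P\otimes f$ and $f\otimes P$ mean $id_P\otimes f$ and $f\otimes id_P$. Monoids $(A,\eta_A,\mu_A)$ (unit, product) and comonoids $(D,\varepsilon_D,\delta_D)$ (counit, coproduct) and their morphisms are the usual (co)associative (co)unital ones. For comonoids $D,E$, $D\otimes E$ is a comonoid with $\varepsilon_{D\otimes E}=\varepsilon_D\otimes\varepsilon_E$, $\delta_{D\otimes E}=(D\otimes c_{D,E}\otimes E)\circ(\delta_D\otimes\delta_E)$. Left modules over a monoid are the usual unital ones. **Bimonoids, Hopf monoids.** A non-unital bimonoid is a comonoid $(B,\varepsilon_B,\delta_B)$ with an associative product $\mu_B:B\otimes B\to B$ (no unit required) that is a comonoid morphism; morphisms of non-unital bimonoids are multiplicative comonoid morphisms. A bimonoid is an object that is a monoid and a comonoid such that unit and product are comonoid morphisms; a Hopf monoid is a bimonoid $H$ with an antipode $\lambda_H:H\to H$, i.e. $\mu_H\circ(H\otimes\lambda_H)\circ\delta_H=\eta_H\circ\varepsilon_H=\mu_H\circ(\lambda_H\otimes H)\circ\delta_H$. **Hopf trusses.** A Hopf truss $\mathbb{H}=(H_1,H_2,\sigma_H)$ in $\mathsf{C}$ consists of a comonoid $(H,\varepsilon_H,\delta_H)$ together with $\eta_H,\mu_H^1,\mu_H^2,\lambda_H,\sigma_H$ such that $H_1=(H,\eta_H,\mu_H^1,\varepsilon_H,\delta_H,\lambda_H)$ is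 a Hopf monoid, $H_2=(H,\mu_H^2,\varepsilon_H,\delta_H)$ is a non-unital bimonoid, $\sigma_H:H\to H$ is a comonoid morphism, and $$\mu_H^2\circ(H\otimes\mu_H^1)=\mu_H^1\circ(\mu_H^2\otimes\Gamma_{H_1}^{\sigma_H})\circ(H\otimes c_{H,H}\otimes H)\circ(\delta_H\otimes H\otimes H),$$ where $\Gamma_{H_1}^{\sigma_H}=\mu_H^1\circ((\lambda_H\circ\sigma_H)\otimes\mu_H^2)\circ(\delta_H\otimes H)$. **Non-unital module monoids.** For a non-unital bimonoid $B$, a non-unital left $B$-module is a pair $(M,\phi_M)$ with $\phi_M:B\otimes M\to M$ satisfying $\phi_M\circ(B\otimes\phi_M)=\phi_M\circ(\mu_B\otimes M)$. A monoid $A$ with $\phi_A:B\otimes A\to A$ is a non-unital left $B$-module monoid if $(A,\phi_A)$ is a non-unital left $B$-module, $\phi_A\circ(B\otimes\eta_A)=\varepsilon_B\otimes\eta_A$, and $\phi_A\circ(B\otimes\mu_A)=\mu_A\circ(\phi_A\otimes\phi_A)\circ(B\otimes c_{B,A}\otimes A)\circ(\delta_B\otimes A\otimes A)$. For a Hopf truss, $H_1$ is a non-unital left $H_2$-module monoid via $\Gamma_{H_1}^{\sigma_H}$. **Generalized invertible 1-cocycles.** Let $H$ be a Hopf monoid, $B$ a non-unital bimonoid, and suppose $H$ is a non-unital left $B$-module monoid with action $\phi_H$. A comonoid morphism $\pi:B\to H$ is a generalized invertible 1-cocycle if it is an isomorphism and there is a comonoid endomorphism $\theta_\pi:B\to B$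 with $$\pi\circ\mu_B=\mu_H\circ((\pi\circ\theta_\pi)\otimes\phi_H)\circ(\delta_B\otimes\pi).$$ It is denoted $(\pi:B\to H,\theta_\pi)$. For every Hopf truss, $(id_H:H_2\to H_1,\sigma_H)$ is one, with action $\Gamma_{H_1}^{\sigma_H}$. **Modules over a Hopf truss.** A left $\mathbb{H}$-module is a triple $(M,\psi_M^1,\psi_M^2)$ where $(M,\psi_M^1)$ is a left $H_1$-module, $(M,\psi_M^2)$ is a non-unital left $H_2$-module and $$\psi_M^2\circ(H\otimes\psi_M^1)=\psi_M^1\circ(\mu_H^2\otimes\Gamma_M^{\sigma_H})\circ(H\otimes c_{H,H}\otimes M)\circ(\delta_H\otimes H\otimes M),$$ with $\Gamma_M^{\sigma_H}=\psi_M^1\circ((\lambda_H\circ\sigma_H)\otimes\psi_M^2)\circ(\delta_H\otimes M)$. Morphisms are morphisms of $\mathsf{C}$ that are linear for both actions. The category is ${}_{\mathbb{H}}\mathsf{Mod}$. **Modules over a generalized invertible 1-cocycle.** A left module over $(\pi:B\to H,\theta_\pi)$ is a 6-tuple $(M,N,\phi_M,\varphi_M,\phi_N,\gamma)$ where: (i) $\phi_M:B\otimes M\to M$ is a morphism in $\mathsf{C}$; (ii) $(M,\varphi_M)$ is a left $H$-module; (iii) $(N,\phi_N)$ is a non-unital left $B$-module; (iv) $\phi_M\circ(B\otimes\varphi_M)=\varphi_M\circ(\phi_H\otimes\phi_M)\circ(B\otimes c_{B,H}\otimes M)\circ(\delta_B\otimes H\otimes M)$; (v) $\gamma:N\to M$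 is an isomorphism in $\mathsf{C}$ with $\gamma\circ\phi_N=\varphi_M\circ((\pi\circ\theta_\pi)\otimes\phi_M)\circ(\delta_B\otimes\gamma)$. A morphism to $(M',N',\phi_{M'},\varphi_{M'},\phi_{N'},\gamma')$ is a pair $(h,l)$ of morphisms $h:M\to M'$, $l:N\to N'$ in $\mathsf{C}$ with $h\circ\phi_M=\phi_{M'}\circ(B\otimes h)$, $h$ left $H$-linear, $l$ left $B$-linear, and $h\circ\gamma=\gamma'\circ l$. The category is ${}_{(\pi,\phi_H,\theta_\pi)}\mathsf{Mod}$. *)

(* Defs.v *)
From Corelib Require Import ssreflect ssrfun ssrbool.
From Stdlib Require Import ProofIrrelevance ClassicalEpsilon.

Set Implicit Arguments.
Unset Strict Implicit.
Unset Printing Implicit Defensive.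

Record category := Category {
  Ob :> Type;
  Hom : Ob -> Ob -> Type;
  idm : forall A, Hom A A;
  comp : forall A B D, Hom B D -> Hom A B -> Hom A D;
  comp1m : forall A B (f : Hom A B), comp (idm B) f = f;
  compm1 : forall A B (f : Hom A B), comp f (idm A) = f;
  compA : forall A B D E (h : Hom D E) (g : Hom B D) (f : Hom A B),
    comp h (comp g f) = comp (comp h g) f
}.

Arguments Hom {c} A B.
Arguments idm {c} A.
Arguments comp {c A B D} g f.

Notation "g ∘ f" := (comp g f) (at level 40, left associativity).

Record functor (C D : category) := Functor {
  fob :> C -> D;
  fmap : forall A B : C, Hom A B -> Hom (fob A) (fob B);
  fmap_id : forall A : C, fmap (idm A) = idm (fob A);
  fmap_comp : forall (A B E : C) (g : Hom B E) (f : Hom A B),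
    fmap (g ∘ f) = fmap g ∘ fmap f
}.

Arguments fmap {C D} f {A B} _ : rename.

Definition is_iso (C : category) (A B : C) (f : Hom A B) : Prop :=
  exists g : Hom B A, g ∘ f = idm A /\ f ∘ g = idm B.

(** In a strict monoidal category, [A ⊗ (B ⊗ D)] and [(A ⊗ B) ⊗ D] are equal
    but not convertible.  Morphisms are therefore compared as elements of the
    total type of arrows, and [g ⊙ f] composes [f] with [g] when the target of
    [f] and the source of [g] are merely equal. *)

Record arrow (C : category) := Arrow {
  src : C;
  tgt : C;
  hom : Hom src tgt
}.

Arguments Arrow {C src tgt} hom.

Notation "f ≡ g" := (Arrow f = Arrow g) (at level 70, no associativity).

Definition castm (C : category) (A B B' : C) (e : B = B') (f : Hom A B) :
  Hom A B' := eq_rect B (Hom A) f B' e.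

Definition compS (C : category) (A B B' D : C) (g : Hom B' D) (f : Hom A B)
  (e : B = B') : Hom A D := g ∘ castm e f.

Reserved Notation "A ⊗ B" (at level 35, right associativity).
Reserved Notation "f ⊠ g" (at level 35, right associativity).

Record strict_monoidal := StrictMonoidal {
  smcat :> category;
  tens : smcat -> smcat -> smcat
    where "A ⊗ B" := (tens A B);
  unitO : smcat;
  tensm : forall A A' B B' : smcat,
    Hom A A' -> Hom B B' -> Hom (A ⊗ B) (A' ⊗ B')
    where "f ⊠ g" := (tensm f g);
  tensm_id : forall A B : smcat, idm A ⊠ idm B = idm (A ⊗ B);
  tensm_comp : forall (A A' A'' B B' B'' : smcat)
    (g : Hom A' A'') (f : Hom A A') (g' : Hom B' B'') (f' : Hom B B'),
    (g ∘ f) ⊠ (g' ∘ f') = (g ⊠ g') ∘ (f ⊠ f');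
  tensA : forall A B D : smcat, A ⊗ (B ⊗ D) = (A ⊗ B) ⊗ D;
  tens1o : forall A : smcat, unitO ⊗ A = A;
  tenso1 : forall A : smcat, A ⊗ unitO = A;
  tensmA : forall (A A' B B' D D' : smcat)
    (f : Hom A A') (g : Hom B B') (h : Hom D D'),
    f ⊠ (g ⊠ h) ≡ (f ⊠ g) ⊠ h;
  tens1m : forall (A A' : smcat) (f : Hom A A'), idm unitO ⊠ f ≡ f;
  tensm1 : forall (A A' : smcat) (f : Hom A A'), f ⊠ idm unitO ≡ f
}.

Arguments tens {s} A B.
Arguments unitO {s}.
Arguments tensm {s A A' B B'} f g.

Notation "A ⊗ B" := (tens A B).
Notation "f ⊠ g" := (tensm f g).

Ltac strict := solve [reflexivity | by rewrite -?tensA ?tens1o ?tenso1].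

Notation "g ⊙ f" := (compS g f ltac:(strict))
  (at level 40, left associativity, only parsing).
Notation "g ⊙ f" := (compS g f _)
  (at level 40, left associativity, only printing).

Record strict_braided := StrictBraided {
  sbcat :> strict_monoidal;
  braid : forall A B : sbcat, Hom (A ⊗ B) (B ⊗ A);
  braid_iso : forall A B : sbcat, is_iso (braid A B);
  braid_nat : forall (A A' B B' : sbcat) (f : Hom A A') (g : Hom B B'),
    braid A' B' ∘ (f ⊠ g) = (g ⊠ f) ∘ braid A B;
  braid_hexl : forall A B D : sbcat,
    braid A (B ⊗ D) ≡ (idm B ⊠ braid A D) ⊙ (braid A B ⊠ idm D);
  braid_hexr : forall A B D : sbcat,
    braid (A ⊗ B) D ≡ (braid A D ⊠ idm B) ⊙ (idm A ⊠ braid B D)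
}.

Arguments braid {s} A B.

Record monoid (C : strict_braided) := Monoid {
  mon_ob :> C;
  munit : Hom unitO mon_ob;
  mmul : Hom (mon_ob ⊗ mon_ob) mon_ob;
  mmulA : mmul ∘ (idm mon_ob ⊠ mmul) ≡ mmul ∘ (mmul ⊠ idm mon_ob);
  mmul1m : mmul ∘ (munit ⊠ idm mon_ob) ≡ idm mon_ob;
  mmulm1 : mmul ∘ (idm mon_ob ⊠ munit) ≡ idm mon_ob
}.

Record comonoid (C : strict_braided) := Comonoid {
  com_ob :> C;
  counit : Hom com_ob unitO;
  comul : Hom com_ob (com_ob ⊗ com_ob);
  comulA : (idm com_ob ⊠ comul) ∘ comul ≡ (comul ⊠ idm com_ob) ∘ comul;
  comul1m : (counit ⊠ idm com_ob) ∘ comul ≡ idm com_ob;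
  comulm1 : (idm com_ob ⊠ counit) ∘ comul ≡ idm com_ob
}.

Arguments munit {C} A : rename.
Arguments mmul {C} A : rename.
Arguments counit {C} D : rename.
Arguments comul {C} D : rename.

Record is_comonoid_mor (C : strict_braided) (D E : comonoid C) (f : Hom D E) :
  Prop := IsComonoidMor {
  comor_counit : counit E ∘ f = counit D;
  comor_comul : comul E ∘ f = (f ⊠ f) ∘ comul D
}.

(** [cmp] is composition on the total type of arrows; it is meaningful only when
    [tgt f = src g].  On arrows the strictness equations hold on the nose. *)

Section Calculus.
Variable C : strict_braided.
Implicit Types (A B D E : C) (f g h : arrow C).

Lemma arrow_inj A B (f g : Hom A B) : f ≡ g -> f = g.
Proof.
move=> e; pose T (a : arrow C) := {p : C * C & Hom (fst p) (snd p)}.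
have e' : existT (fun p : C * C => Hom (fst p) (snd p)) (A, B) f
        = existT (fun p : C * C => Hom (fst p) (snd p)) (A, B) g.
  exact: (f_equal (fun a : arrow C =>
    existT (fun p : C * C => Hom (fst p) (snd p)) (src a, tgt a) (hom a)) e).
exact: (ProofIrrelevanceTheory.EqdepTheory.inj_pair2 _ _ _ _ _ e').
Qed.

Lemma castmE A B B' (e : B = B') (f : Hom A B) : castm e f ≡ f.
Proof. by case: B' / e. Qed.

Definition cmp g f : arrow C :=
  match excluded_middle_informative (tgt f = src g) with
  | left e => Arrow (compS (hom g) (hom f) e)
  | right _ => f
  end.

Definition ida A : arrow C := Arrow (idm A).
Definition tns f g : arrow C := Arrow (hom f ⊠ hom g).
Definition brd A B : arrow C := Arrow (braid A B).

Lemma compSE A B B' D (g : Hom B' D) (f : Hom A B) (e : B = B') :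
  Arrow (compS g f e) = cmp (Arrow g) (Arrow f).
Proof.
rewrite /cmp; case: excluded_middle_informative => //= e'.
by rewrite (proof_irrelevance _ e e').
Qed.

Lemma compE A B D (g : Hom B D) (f : Hom A B) :
  Arrow (g ∘ f) = cmp (Arrow g) (Arrow f).
Proof. exact: (compSE g f eq_refl). Qed.

Lemma tensE A A' B B' (f : Hom A A') (g : Hom B B') :
  Arrow (f ⊠ g) = tns (Arrow f) (Arrow g).
Proof. by []. Qed.

Lemma idmE A : Arrow (idm A) = ida A. Proof. by []. Qed.
Lemma braidE A B : Arrow (braid A B) = brd A B. Proof. by []. Qed.

Lemma src_cmp g f : src (cmp g f) = src f.
Proof. by rewrite /cmp; case: excluded_middle_informative. Qed.

Lemma tgt_cmp g f : tgt f = src g -> tgt (cmp g f) = tgt g.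
Proof. by rewrite /cmp; case: excluded_middle_informative. Qed.

Lemma cmp1 B f : tgt f = B -> cmp (ida B) f = f.
Proof. by case: f => A A' f /= <-; rewrite -idmE -compE comp1m. Qed.

Lemma cmpI A f : src f = A -> cmp f (ida A) = f.
Proof. by case: f => A1 A' f /= <-; rewrite -idmE -compE compm1. Qed.

Lemma cmpA h g f : tgt f = src g -> tgt g = src h ->
  cmp (cmp h g) f = cmp h (cmp g f).
Proof.
case: h g f => [D E h] [B D' g] [A B' f] /= e e'; subst.
by rewrite -!compE compA.
Qed.

Lemma tnsI A B : tns (ida A) (ida B) = ida (A ⊗ B).
Proof. by rewrite /tns /= tensm_id. Qed.

Lemma tnsA f g h : tns (tns f g) h = tns f (tns g h).
Proof. exact: esym (tensmA _ _ _). Qed.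

Lemma tns1 f : tns (ida unitO) f = f.
Proof. by case: f => A B f; exact: tens1m. Qed.

Lemma tnsU f : tns f (ida unitO) = f.
Proof. by case: f => A B f; exact: tensm1. Qed.

Lemma tns_cmp g f g' f' : tgt f = src g -> tgt f' = src g' ->
  tns (cmp g f) (cmp g' f') = cmp (tns g g') (tns f f').
Proof.
case: g f g' f' => [B D g] [A B1 f] [B' D' g'] [A' B1' f'] /= e e'; subst.
by rewrite -!compE -!tensE tensm_comp compE.
Qed.

Lemma brd_nat f g :
  cmp (brd (tgt f) (tgt g)) (tns f g) = cmp (tns g f) (brd (src f) (src g)).
Proof. by case: f g => [A A' f] [B B' g]; rewrite -!tensE -!braidE -!compE braid_nat. Qed.

Lemma brd_hexl A B D : brd A (B ⊗ D) =
  cmp (tns (ida B) (brd A D)) (tns (brd A B) (ida D)).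
Proof. by rewrite -braidE braid_hexl compSE. Qed.

Lemma brd_hexr A B D : brd (A ⊗ B) D =
  cmp (tns (brd A D) (ida B)) (tns (ida A) (brd B D)).
Proof. by rewrite -braidE braid_hexr compSE. Qed.

Lemma ida_src A : src (ida A) = A. Proof. by []. Qed.

Lemma brd_idem_id A f : src f = A -> tgt f = A ->
  (exists g, [/\ src g = A, tgt g = A & cmp g f = ida A]) ->
  cmp f f = f -> f = ida A.
Proof.
move=> sf tf [g [sg tg e]] ff.
by rewrite -(cmp1 tf) -{1}e cmpA ?tf ?sg ?sf // ff e.
Qed.

Lemma brd_inv A B : exists g,
  [/\ src g = B ⊗ A, tgt g = A ⊗ B & cmp g (brd A B) = ida (A ⊗ B)].
Proof.
have [g [e _]] := braid_iso A B.
by exists (Arrow g); split=> //; rewrite -braidE -compE e.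
Qed.

Lemma brd1 A : brd unitO A = ida A.
Proof.
have [g [sg tg e]] := brd_inv unitO A.
apply: brd_idem_id => //=; rewrite ?tens1o ?tenso1 //.
  by exists g; rewrite sg tg e tens1o tenso1.
have := brd_hexr unitO unitO A.
by rewrite tens1o tnsU tns1 => <-.
Qed.

Lemma brdU A : brd A unitO = ida A.
Proof.
have [g [sg tg e]] := brd_inv A unitO.
apply: brd_idem_id => //=; rewrite ?tens1o ?tenso1 //.
  by exists g; rewrite sg tg e tens1o tenso1.
have := brd_hexl A unitO unitO.
by rewrite tens1o tnsU tns1 => <-.
Qed.

End Calculus.

Ltac ty_step := first
  [ rewrite src_cmp | rewrite tgt_cmp | progress simpl
  | match goal with
    | e : src ?f = _ |- context [src ?f] => rewrite e
    | e : tgt ?f = _ |- context [tgt ?f] => rewrite e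
    end ].

Ltac ty :=
  solve [repeat ty_step; rewrite -?tensA ?tens1o ?tenso1 -?tensA; reflexivity].

#[local] Hint Extern 0 (tgt _ = _) => ty : core.
#[local] Hint Extern 0 (src _ = _) => ty : core.

(** The operation [box D Y Y' F G], for [F : D ⊗ Y -> Z] and
    [G : D ⊗ Y' -> Z'], distributes the comonoid variable [D] by [comul D]:
    it is the tensor of [F] and [G] as families of morphisms parametrized by
    [D].  With [Y = unitO] and a product after it, it is the convolution. *)

Section Box.
Variable C : strict_braided.
Implicit Types (Y Z : C) (F G a b f g h : arrow C).

Lemma tns_cmpl g f Y : tgt f = src g ->
  tns (cmp g f) (ida Y) = cmp (tns g (ida Y)) (tns f (ida Y)).
Proof. by move=> e; rewrite -tns_cmp // cmpI. Qed.

Lemma tns_cmpr g f Y : tgt f = src g ->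
  tns (ida Y) (cmp g f) = cmp (tns (ida Y) g) (tns (ida Y) f).
Proof. by move=> e; rewrite -tns_cmp // cmpI. Qed.

Lemma tns_exl f g : tns f g = cmp (tns f (ida (tgt g))) (tns (ida (src f)) g).
Proof. by rewrite -tns_cmp // cmpI // cmp1. Qed.

Lemma tns_exr f g : tns f g = cmp (tns (ida (tgt f)) g) (tns f (ida (src g))).
Proof. by rewrite -tns_cmp // cmpI // cmp1. Qed.

Variable D : comonoid C.

Definition dlt : arrow C := Arrow (comul D).
Definition eps : arrow C := Arrow (counit D).

Lemma dltA : cmp (tns (ida D) dlt) dlt = cmp (tns dlt (ida D)) dlt.
Proof. by rewrite /dlt -idmE -!tensE -!compE comulA. Qed.
Lemma dlt1 : cmp (tns eps (ida D)) dlt = ida D.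
Proof. by rewrite /dlt /eps -idmE -!tensE -!compE comul1m. Qed.
Lemma dltU : cmp (tns (ida D) eps) dlt = ida D.
Proof. by rewrite /dlt /eps -idmE -!tensE -!compE comulm1. Qed.

Definition spread Y Y' : arrow C :=
  cmp (tns (ida D) (tns (brd D Y) (ida Y'))) (tns dlt (ida (Y ⊗ Y'))).

Definition box Y Y' F G : arrow C := cmp (tns F G) (spread Y Y').

Lemma src_spread Y Y' : src (spread Y Y') = D ⊗ (Y ⊗ Y').
Proof. by rewrite src_cmp. Qed.
Lemma tgt_spread Y Y' : tgt (spread Y Y') = D ⊗ Y ⊗ D ⊗ Y'.
Proof. by rewrite /spread. Qed.

Lemma src_box Y Y' F G : src (box Y Y' F G) = D ⊗ (Y ⊗ Y').
Proof. by rewrite src_cmp src_spread. Qed.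

Lemma tgt_box Y Y' F G : src F = D ⊗ Y -> src G = D ⊗ Y' ->
  tgt (box Y Y' F G) = tgt F ⊗ tgt G.
Proof. by move=> sF sG; rewrite tgt_cmp //= tgt_spread sF sG -tensA. Qed.

#[local] Hint Resolve src_spread tgt_spread src_box : core.

Lemma box_post Y Y' F G a b : src F = D ⊗ Y -> src G = D ⊗ Y' ->
  tgt F = src a -> tgt G = src b ->
  cmp (tns a b) (box Y Y' F G) = box Y Y' (cmp a F) (cmp b G).
Proof.
by move=> sF sG ea eb; rewrite /box -cmpA // tns_cmp.
Qed.

Lemma spread_nat a b :
  cmp (spread (tgt a) (tgt b)) (tns (ida D) (tns a b)) =
  cmp (tns (tns (ida D) a) (tns (ida D) b)) (spread (src a) (src b)).
Proof.
rewrite /spread cmpA // -tns_cmp // cmpI // cmp1 //.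
have e : dlt = cmp (ida (D ⊗ D)) dlt by rewrite cmp1.
rewrite [X in tns X (tns a b)]e.
have e2 : tns a b = cmp (tns a b) (ida (src a ⊗ src b)) by rewrite cmpI.
rewrite [in LHS]e2.
rewrite tns_cmp // -!cmpA //; congr cmp.
rewrite -!tnsI !tnsA -tns_cmp // -[RHS]tns_cmp //; congr tns.
rewrite -!tnsA -tns_cmp // -[RHS]tns_cmp // cmp1 // cmpI //.
by rewrite (brd_nat (ida D) a).
Qed.

Lemma box_pre Y Y' F G a b :
  src F = D ⊗ tgt a -> src G = D ⊗ tgt b -> src a = Y -> src b = Y' ->
  cmp (box (tgt a) (tgt b) F G) (tns (ida D) (tns a b)) =
  box Y Y' (cmp F (tns (ida D) a)) (cmp G (tns (ida D) b)).
Proof.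
move=> sF sG <- <-; rewrite /box cmpA //.
by rewrite spread_nat -cmpA // -tns_cmp.
Qed.

Lemma exch f g : cmp (tns f (ida (tgt g))) (tns (ida (src f)) g) =
  cmp (tns (ida (tgt f)) g) (tns f (ida (src g))).
Proof. by rewrite -tns_exl -tns_exr. Qed.

Lemma cmpAx f g h a : cmp f g = h -> tgt a = src g -> tgt g = src f ->
  cmp f (cmp g a) = cmp h a.
Proof. by move=> <- e e'; rewrite cmpA. Qed.

Lemma spreadA Y Y' Y'' :
  cmp (tns (spread Y Y') (ida (D ⊗ Y''))) (spread (Y ⊗ Y') Y'') =
  cmp (tns (ida (D ⊗ Y)) (spread Y' Y'')) (spread Y (Y' ⊗ Y'')).
Proof.
rewrite /spread brd_hexl tns_cmpl // tns_cmpr // tns_cmpl // tns_cmpr //.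
rewrite -!tnsI !tnsA -?tnsI ?tnsA.
have E1 := exch dlt (tns (ida Y) (tns (brd D Y') (ida Y''))).
have E2 := exch dlt (tns (brd D Y) (ida (Y' ⊗ Y''))).
have E3 := exch (tns (ida D) (brd D Y)) (tns (brd D Y') (ida Y'')).
have E4 : cmp (tns (ida Y) dlt) (brd D Y) =
  cmp (tns (brd D Y) (ida D)) (cmp (tns (ida D) (brd D Y)) (tns dlt (ida Y))).
  by rewrite -cmpA // -brd_hexr; exact: esym (brd_nat dlt (ida Y)).
have {}E4 := f_equal (fun x => tns (ida D) (tns x (ida (Y' ⊗ Y'')))) E4.
rewrite !tns_cmpl // !tns_cmpr // in E4.
have E5 := f_equal (fun x => tns x (ida (Y ⊗ Y' ⊗ Y''))) dltA.
rewrite !tns_cmpl // in E5.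
rewrite /= -?tnsI ?tnsA in E1 E2 E3 E4 E5.
rewrite !cmpA // (cmpAx E1) // !cmpA // (cmpAx E2) // (cmpAx E3) //.
by rewrite (cmpAx E4) // !cmpA // E5.
Qed.

Lemma boxA Y Y' Y'' F G h : src F = D ⊗ Y -> src G = D ⊗ Y' ->
  src h = D ⊗ Y'' ->
  box (Y ⊗ Y') Y'' (box Y Y' F G) h = box Y (Y' ⊗ Y'') F (box Y' Y'' G h).
Proof.
move=> sF sG sh; rewrite /box.
have -> : tns (cmp (tns F G) (spread Y Y')) h =
    cmp (tns (tns F G) h) (tns (spread Y Y') (ida (D ⊗ Y''))).
  by rewrite -tns_cmp // cmpI.
have -> : tns F (cmp (tns G h) (spread Y' Y'')) =
    cmp (tns F (tns G h)) (tns (ida (D ⊗ Y)) (spread Y' Y'')).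
  by rewrite -tns_cmp // cmpI.
by rewrite !cmpA // spreadA tnsA.
Qed.

Lemma spread1 Y : spread unitO Y = tns dlt (ida Y).
Proof.
by rewrite /spread brdU tens1o !tnsI cmp1 // tens1o.
Qed.

Lemma spreadU Y : spread Y unitO = cmp (tns (ida D) (brd D Y)) (tns dlt (ida Y)).
Proof. by rewrite /spread tenso1 tnsU. Qed.

Lemma box_eps Y G : src G = D ⊗ Y -> box unitO Y eps G = G.
Proof.
move=> sG; rewrite /box spread1 (tns_exr eps G) /= sG tns1 cmpA //.
by rewrite -tnsI -tnsA -tns_cmpl // dlt1 tnsI cmpI.
Qed.

Lemma box_epsr Y F : src F = D ⊗ Y -> box Y unitO F eps = F.
Proof.
move=> sF; rewrite /box spreadU (tns_exl F eps) /= sF tnsU cmpA //.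
rewrite -tnsI tnsA -[X in cmp F X]cmpA // -tns_cmpr //.
have := brd_nat eps (ida Y); rewrite /= brd1 cmp1 // => <-.
by rewrite -tnsA -tns_cmpl // dltU tnsI cmpI.
Qed.

End Box.

Section TensComonoid.
Variable C : strict_braided.

Definition unit_comul : Hom (unitO : C) (unitO ⊗ unitO) :=
  castm (esym (tens1o unitO)) (idm unitO).

Lemma unit_comulE : Arrow unit_comul = ida unitO.
Proof. exact: castmE. Qed.

Lemma unit_comulA :
  (idm unitO ⊠ unit_comul) ∘ unit_comul ≡ (unit_comul ⊠ idm unitO) ∘ unit_comul.
Proof. by rewrite !compE !tensE unit_comulE !idmE tns1. Qed.

Lemma unit_comul1 : (idm unitO ⊠ idm unitO) ∘ unit_comul ≡ idm (unitO : C).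
Proof. by rewrite !compE !tensE unit_comulE !idmE tns1 cmp1. Qed.

Definition unit_comonoid : comonoid C :=
  Comonoid unit_comulA unit_comul1 unit_comul1.

Variables D E : comonoid C.

Definition tens_counit : Hom (D ⊗ E) unitO :=
  castm (tens1o unitO) (counit D ⊠ counit E).

Lemma tens_mid (X Y : C) : X ⊗ (Y ⊗ X) ⊗ Y = (X ⊗ Y) ⊗ (X ⊗ Y).
Proof. by rewrite -!tensA. Qed.

Definition tens_comul : Hom (D ⊗ E) ((D ⊗ E) ⊗ (D ⊗ E)) :=
  castm (tens_mid D E)
    ((idm D ⊠ braid D E ⊠ idm E) ⊙ (comul D ⊠ comul E)).

Lemma tens_counitE : Arrow tens_counit = tns (eps D) (eps E).
Proof. by rewrite castmE. Qed.

Lemma tens_comulE :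
  Arrow tens_comul = cmp (spread D E E) (tns (ida D) (dlt E)).
Proof.
rewrite castmE compSE !tensE (tns_exl (Arrow (comul D))) /spread cmpA //.
Qed.

Lemma box_id : spread D E E = box D E E (ida (D ⊗ E)) (ida (D ⊗ E)).
Proof. by rewrite /box tnsI cmp1. Qed.

Lemma box_comul (F G : arrow C) : src F = D ⊗ E -> src G = D ⊗ E ->
  cmp (tns F G) (Arrow tens_comul) = cmp (box D E E F G) (tns (ida D) (dlt E)).
Proof. by move=> sF sG; rewrite tens_comulE /box cmpA. Qed.

Lemma tens_comulA :
  (idm (D ⊗ E) ⊠ tens_comul) ∘ tens_comul
  ≡ (tens_comul ⊠ idm (D ⊗ E)) ∘ tens_comul.
Proof.
rewrite !compE !tensE idmE !box_comul // tens_comulE box_id.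
set I := ida (D ⊗ E).
have -> : box D E E I (cmp (box D E E I I) (tns (ida D) (dlt E))) =
    cmp (box D E (E ⊗ E) I (box D E E I I)) (tns (ida D) (tns (ida E) (dlt E))).
  by rewrite (@box_pre _ D E E _ _ (ida E) (dlt E)) // tnsI [cmp I _]cmpI.
have -> : box D E E (cmp (box D E E I I) (tns (ida D) (dlt E))) I =
    cmp (box D (E ⊗ E) E (box D E E I I) I) (tns (ida D) (tns (dlt E) (ida E))).
  by rewrite (@box_pre _ D E E _ _ (dlt E) (ida E)) // tnsI [cmp I _]cmpI.
by rewrite boxA // [LHS]cmpA // [RHS]cmpA // -!tns_cmpr // dltA.
Qed.

Lemma tens_comul1 : (tens_counit ⊠ idm (D ⊗ E)) ∘ tens_comul ≡ idm (D ⊗ E).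
Proof.
rewrite !compE !tensE !idmE tens_counitE box_comul //.
have -> : box D E E (tns (eps D) (eps E)) (ida (D ⊗ E)) =
    cmp (box D unitO E (eps D) (ida (D ⊗ E))) (tns (ida D) (tns (eps E) (ida E))).
  rewrite (@box_pre _ D E E _ _ (eps E) (ida E)) // tnsI cmpI //.
  by rewrite (tns_exl (eps D) (eps E)) /= tnsU.
by rewrite box_eps // cmpA // -tns_cmpr // dlt1 tnsI cmp1.
Qed.

Lemma tens_comulU : (idm (D ⊗ E) ⊠ tens_counit) ∘ tens_comul ≡ idm (D ⊗ E).
Proof.
rewrite !compE !tensE !idmE tens_counitE box_comul //.
have -> : box D E E (ida (D ⊗ E)) (tns (eps D) (eps E)) =
    cmp (box D E unitO (ida (D ⊗ E)) (eps D)) (tns (ida D) (tns (ida E) (eps E))).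
  rewrite (@box_pre _ D E E _ _ (ida E) (eps E)) // tnsI cmpI //.
  by rewrite (tns_exl (eps D) (eps E)) /= tnsU.
by rewrite box_epsr // cmpA // -tns_cmpr // dltU tnsI cmp1.
Qed.

Definition tens_comonoid : comonoid C :=
  Comonoid tens_comulA tens_comul1 tens_comulU.

Lemma box_tens (Y : C) (F G : arrow C) :
  src F = D ⊗ E -> src G = D ⊗ E ⊗ Y ->
  @box _ tens_comonoid unitO Y F G =
  cmp (box D E (E ⊗ Y) F G) (tns (ida D) (tns (dlt E) (ida Y))).
Proof.
move=> sF sG; rewrite /box spread1 [dlt tens_comonoid]tens_comulE.
rewrite [in RHS]cmpA //; congr cmp.
rewrite tns_cmpl // tnsA; congr cmp.
by rewrite /spread tns_cmpl // -!tnsI !tnsA.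
Qed.

End TensComonoid.

Record nu_bimonoid (C : strict_braided) := NuBimonoid {
  nub_com :> comonoid C;
  nub_mul : Hom (nub_com ⊗ nub_com) nub_com;
  nub_mulA : nub_mul ∘ (idm nub_com ⊠ nub_mul) ≡ nub_mul ∘ (nub_mul ⊠ idm nub_com);
  nub_mul_comor : is_comonoid_mor (D := tens_comonoid nub_com nub_com) nub_mul
}.

Record bimonoid (C : strict_braided) := Bimonoid {
  bim_com :> comonoid C;
  bim_unit : Hom unitO bim_com;
  bim_mul : Hom (bim_com ⊗ bim_com) bim_com;
  bim_mulA : bim_mul ∘ (idm bim_com ⊠ bim_mul) ≡ bim_mul ∘ (bim_mul ⊠ idm bim_com);
  bim_mul1m : bim_mul ∘ (bim_unit ⊠ idm bim_com) ≡ idm bim_com;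
  bim_mulm1 : bim_mul ∘ (idm bim_com ⊠ bim_unit) ≡ idm bim_com;
  bim_unit_comor : is_comonoid_mor (D := unit_comonoid C) bim_unit;
  bim_mul_comor : is_comonoid_mor (D := tens_comonoid bim_com bim_com) bim_mul
}.

Definition bim_mon (C : strict_braided) (B : bimonoid C) : monoid C :=
  Monoid (bim_mulA B) (bim_mul1m B) (bim_mulm1 B).

Record hopf_monoid (C : strict_braided) := HopfMonoid {
  hopf_bim :> bimonoid C;
  antipode : Hom hopf_bim hopf_bim;
  antipoder : bim_mul hopf_bim ∘ (idm hopf_bim ⊠ antipode) ∘ comul hopf_bim
              = bim_unit hopf_bim ∘ counit hopf_bim;
  antipodel : bim_mul hopf_bim ∘ (antipode ⊠ idm hopf_bim) ∘ comul hopf_bim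
              = bim_unit hopf_bim ∘ counit hopf_bim
}.

Arguments nub_mul {C} B : rename.
Arguments bim_unit {C} B : rename.
Arguments bim_mul {C} B : rename.
Arguments antipode {C} H : rename.

(** The morphism [Γ_M] attached to [ψ1] and [ψ2]; [Γ_{H_1}] is the case
    [M = H], [ψ1 = μ1], [ψ2 = μ2]. *)
Definition gamma (C : strict_braided) (H : hopf_monoid C) (sigma : Hom H H)
    (M : C) (psi1 psi2 : Hom (H ⊗ M) M) : Hom (H ⊗ M) M :=
  psi1 ∘ ((antipode H ∘ sigma) ⊠ psi2) ⊙ (comul H ⊠ idm M).

Record hopf_truss (C : strict_braided) := HopfTruss {
  truss1 : hopf_monoid C;
  truss_mul2 : Hom (truss1 ⊗ truss1) truss1;
  truss_mul2A : truss_mul2 ∘ (idm truss1 ⊠ truss_mul2)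
                ≡ truss_mul2 ∘ (truss_mul2 ⊠ idm truss1);
  truss_mul2_comor :
    is_comonoid_mor (D := tens_comonoid truss1 truss1) truss_mul2;
  truss_sigma : Hom truss1 truss1;
  truss_sigma_comor : is_comonoid_mor truss_sigma;
  truss_distr :
    truss_mul2 ∘ (idm truss1 ⊠ bim_mul truss1)
    = bim_mul truss1
      ∘ (truss_mul2 ⊠ gamma truss_sigma (bim_mul truss1) truss_mul2)
      ⊙ (idm truss1 ⊠ braid truss1 truss1 ⊠ idm truss1)
      ⊙ (comul truss1 ⊠ idm truss1 ⊠ idm truss1)
}.

Arguments truss_mul2 {C} H : rename.
Arguments truss_sigma {C} H : rename.

Definition truss2 (C : strict_braided) (H : hopf_truss C) : nu_bimonoid C :=
  NuBimonoid (truss_mul2A H) (truss_mul2_comor H).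

Record is_module (C : strict_braided) (A : monoid C) (M : C)
    (phi : Hom (A ⊗ M) M) : Prop := IsModule {
  modA : phi ∘ (idm A ⊠ phi) ≡ phi ∘ (mmul A ⊠ idm M);
  mod1 : phi ∘ (munit A ⊠ idm M) ≡ idm M
}.

Definition is_nu_module (C : strict_braided) (B : nu_bimonoid C) (M : C)
    (phi : Hom (B ⊗ M) M) : Prop :=
  phi ∘ (idm B ⊠ phi) ≡ phi ∘ (nub_mul B ⊠ idm M).

Record is_nu_module_monoid (C : strict_braided) (B : nu_bimonoid C)
    (A : monoid C) (phi : Hom (B ⊗ A) A) : Prop := IsNuModuleMonoid {
  nmm_module : is_nu_module phi;
  nmm_unit : phi ∘ (idm B ⊠ munit A) ≡ counit B ⊠ munit A;
  nmm_mul : phi ∘ (idm B ⊠ mmul A)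
            = mmul A ∘ (phi ⊠ phi)
              ⊙ (idm B ⊠ braid B A ⊠ idm A)
              ⊙ (comul B ⊠ idm A ⊠ idm A)
}.

(** The endomorphism [coc_theta] is part of the data, as in the notation
    [(π : B -> H, θ_π)]. *)
Record gen_inv_cocycle (C : strict_braided) (B : nu_bimonoid C) (H : hopf_monoid C) :=
  Cocycle {
  coc_act : Hom (B ⊗ H) H;
  coc_actP : is_nu_module_monoid (A := bim_mon H) coc_act;
  coc_map : Hom B H;
  coc_map_comor : is_comonoid_mor coc_map;
  coc_map_iso : is_iso coc_map;
  coc_theta : Hom B B;
  coc_theta_comor : is_comonoid_mor coc_theta;
  coc_mul : coc_map ∘ nub_mul B
            = bim_mul H ∘ ((coc_map ∘ coc_theta) ⊠ coc_act)
              ⊙ (comul B ⊠ coc_map)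
}.

Section Convolution.
Variables (C : strict_braided) (H : hopf_monoid C) (D : comonoid C).
Implicit Types (Y Z : C) (F G h : arrow C).

Let m : arrow C := Arrow (bim_mul H).
Let u : arrow C := Arrow (bim_unit H).

Lemma mulA : cmp m (tns (ida H) m) = cmp m (tns m (ida H)).
Proof. by rewrite /m -idmE -!tensE -!compE bim_mulA. Qed.
Lemma mul1 : cmp m (tns u (ida H)) = ida H.
Proof. by rewrite /m /u -idmE -!tensE -!compE bim_mul1m. Qed.
Lemma mulU : cmp m (tns (ida H) u) = ida H.
Proof. by rewrite /m /u -idmE -!tensE -!compE bim_mulm1. Qed.

Lemma convA Y Y' Y'' F G h :
  src F = D ⊗ Y -> src G = D ⊗ Y' -> src h = D ⊗ Y'' ->
  tgt F = H -> tgt G = H -> tgt h = H ->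
  cmp m (box D Y (Y' ⊗ Y'') F (cmp m (box D Y' Y'' G h))) =
  cmp m (box D (Y ⊗ Y') Y'' (cmp m (box D Y Y' F G)) h).
Proof.
move=> sF sG sh tF tG th.
have tb1 := tgt_box sF sG; have tb2 := tgt_box sG sh.
have -> : box D Y (Y' ⊗ Y'') F (cmp m (box D Y' Y'' G h)) =
    cmp (tns (ida H) m) (box D Y (Y' ⊗ Y'') F (box D Y' Y'' G h)).
  by rewrite box_post // cmp1.
have -> : box D (Y ⊗ Y') Y'' (cmp m (box D Y Y' F G)) h =
    cmp (tns m (ida H)) (box D (Y ⊗ Y') Y'' (box D Y Y' F G) h).
  by rewrite box_post // cmp1.
by rewrite -boxA // -[LHS]cmpA // -[RHS]cmpA // mulA.
Qed.

Lemma convA0 Y F G h :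
  src F = D -> src G = D -> src h = D ⊗ Y ->
  tgt F = H -> tgt G = H -> tgt h = H ->
  cmp m (box D unitO Y F (cmp m (box D unitO Y G h))) =
  cmp m (box D unitO Y (cmp m (box D unitO unitO F G)) h).
Proof.
move=> sF sG sh tF tG th.
by have := @convA unitO unitO Y F G h; rewrite !tens1o !tenso1 => ->.
Qed.

Lemma conv1 Y G : src G = D ⊗ Y -> tgt G = H ->
  cmp m (box D unitO Y (cmp u (eps D)) G) = G.
Proof.
move=> sG tG.
have -> : box D unitO Y (cmp u (eps D)) G =
    cmp (tns u (ida H)) (box D unitO Y (eps D) G).
  by rewrite box_post // cmp1.
by rewrite box_eps // -cmpA // mul1 cmp1.
Qed.

Lemma convU Y F : src F = D ⊗ Y -> tgt F = H ->
  cmp m (box D Y unitO F (cmp u (eps D))) = F.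
Proof.
move=> sF tF.
have -> : box D Y unitO F (cmp u (eps D)) =
    cmp (tns (ida H) u) (box D Y unitO F (eps D)).
  by rewrite box_post // cmp1.
by rewrite box_epsr // -cmpA // mulU cmp1.
Qed.

Lemma box0 F G : box D unitO unitO F G = cmp (tns F G) (dlt D).
Proof. by rewrite /box spread1 tnsU. Qed.

Let l : arrow C := Arrow (antipode H).

Lemma conv_antl (f : Hom D H) : is_comonoid_mor f ->
  cmp m (box D unitO unitO (cmp l (Arrow f)) (Arrow f)) = cmp u (eps D).
Proof.
move=> [fe fd]; rewrite box0.
have -> : tns (cmp l (Arrow f)) (Arrow f) =
    cmp (tns l (ida H)) (tns (Arrow f) (Arrow f)).
  by rewrite -tns_cmp // cmp1.
rewrite /eps /dlt -fe compE cmpA // -tensE -compE -fd.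
have := f_equal (fun x => cmp (Arrow x) (Arrow f)) (antipodel H).
by rewrite !compE !cmpA.
Qed.

Lemma conv_antr (f : Hom D H) : is_comonoid_mor f ->
  cmp m (box D unitO unitO (Arrow f) (cmp l (Arrow f))) = cmp u (eps D).
Proof.
move=> [fe fd]; rewrite box0.
have -> : tns (Arrow f) (cmp l (Arrow f)) =
    cmp (tns (ida H) l) (tns (Arrow f) (Arrow f)).
  by rewrite -tns_cmp // cmp1.
rewrite /eps /dlt -fe compE cmpA // -tensE -compE -fd.
have := f_equal (fun x => cmp (Arrow x) (Arrow f)) (antipoder H).
by rewrite !compE !cmpA.
Qed.

End Convolution.

Section TrussCocycle.
Variables (C : strict_braided) (T : hopf_truss C).
Let H : hopf_monoid C := truss1 T.
Let m : arrow C := Arrow (bim_mul H).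
Let u : arrow C := Arrow (bim_unit H).
Let l : arrow C := Arrow (antipode H).
Let m2 : arrow C := Arrow (truss_mul2 T).
Let s : arrow C := Arrow (truss_sigma T).
Let ls : arrow C := cmp l s.
Let Gam := gamma (truss_sigma T) (bim_mul H) (truss_mul2 T).
Let g : arrow C := Arrow Gam.

Lemma m2A : cmp m2 (tns (ida H) m2) = cmp m2 (tns m2 (ida H)).
Proof. by rewrite /m2 -idmE -!tensE -!compE truss_mul2A. Qed.

Lemma gamE : g = cmp m (box H unitO H ls m2).
Proof. by rewrite /g /Gam /gamma compSE !compE !tensE compE /box spread1 cmpA. Qed.

Lemma distrE : cmp m2 (tns (ida H) m) = cmp m (box H H H m2 g).
Proof.
have := f_equal (@Arrow _ _ _) (truss_distr T).
by rewrite !compSE !compE !tensE !idmE tnsI /box /spread !cmpA.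
Qed.

Let e : arrow C := eps H.
Let d : arrow C := dlt H.

Lemma src_ls : src ls = H. Proof. by []. Qed.
Lemma tgt_ls : tgt ls = H. Proof. by []. Qed.

Lemma gam_mul : cmp g (tns (ida H) m) = cmp m (box H H H g g).
Proof.
rewrite {1}gamE cmpA //.
have -> : cmp (box H unitO H ls m2) (tns (ida H) m) =
    box H unitO (H ⊗ H) ls (cmp m2 (tns (ida H) m)).
  by rewrite -{1}(tns1 m) (@box_pre _ H unitO (H ⊗ H) ls m2 (ida unitO) m) // tnsU cmpI.
by rewrite distrE convA // tens1o -gamE.
Qed.

Lemma m2_counit : cmp e m2 = tns e e.
Proof.
have := f_equal (@Arrow _ _ _) (comor_counit (truss_mul2_comor T)).
by rewrite compE /= tens_counitE.
Qed.

Lemma m2_comul :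
  cmp d m2 = cmp (tns m2 m2) (dlt (tens_comonoid H H)).
Proof.
by have := f_equal (@Arrow _ _ _) (comor_comul (truss_mul2_comor T)); rewrite !compE.
Qed.

Lemma u_counit : cmp e u = ida unitO.
Proof.
by have := f_equal (@Arrow _ _ _) (comor_counit (bim_unit_comor H)); rewrite !compE.
Qed.

Lemma u_comul : cmp d u = tns u u.
Proof.
have := f_equal (@Arrow _ _ _) (comor_comul (bim_unit_comor H)).
by rewrite !compE /= unit_comulE cmpI //= tens1o.
Qed.

Lemma tau_subproof : {tau : Hom H H | Arrow tau = cmp m2 (tns (ida H) u)}.
Proof.
exists ((truss_mul2 T ∘ (idm H ⊠ bim_unit H)) ⊙ idm H).
by rewrite compSE compE cmpI //= tenso1.
Qed.

Let tau : Hom H H := proj1_sig tau_subproof.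
Let t : arrow C := Arrow tau.

Lemma tauE : t = cmp m2 (tns (ida H) u).
Proof. exact: proj2_sig tau_subproof. Qed.

Lemma tau_comor : is_comonoid_mor tau.
Proof.
split; apply: arrow_inj; rewrite !compE -/t tauE -/e.
- rewrite -[LHS]cmpA // m2_counit -tns_cmp // u_counit tnsU.
  by rewrite -[Arrow (counit _)]/(eps H) cmpI.
- rewrite !tensE -/t -[LHS]cmpA // m2_comul [dlt _]tens_comulE.
  rewrite cmpA // [cmp (cmp (spread _ _ _) _) _]cmpA // -tns_cmpr // -/d u_comul.
  have := spread_nat H u u => /= ->.
  rewrite -cmpA // -tns_cmp // -tauE spread1; congr cmp.
  by rewrite tnsU.
Qed.

Lemma tau_conv : t = cmp m (box H unitO unitO t (cmp g (tns (ida H) u))).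
Proof.
have uu : cmp m (tns u u) = u.
  by rewrite (tns_exl u u) -cmpA // mul1 tns1 cmp1.
rewrite {1}tauE -{1}uu tns_cmpr // -cmpA // distrE cmpA //.
by rewrite (@box_pre _ H unitO unitO m2 g u u) // tauE.
Qed.

Lemma gam_unit0 : cmp g (tns (ida H) u) = cmp m (box H unitO unitO ls t).
Proof.
rewrite {1}gamE cmpA // tauE.
have := @box_pre _ H unitO unitO ls m2 (ida unitO) u.
by rewrite tns1 tnsU cmpI // => <-.
Qed.

Lemma src_t : src t = H. Proof. by []. Qed.

Lemma gam_unit : cmp g (tns (ida H) u) = cmp u e.
Proof.
have [sg tg] : src (cmp g (tns (ida H) u)) = H /\ tgt (cmp g (tns (ida H) u)) = H.
  by split; ty.
have E := conv_antl tau_comor.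
rewrite -E -/t {2}tau_conv convA0 //.
by rewrite -/t -/l -/m E conv1.
Qed.

Lemma tau_sigma : t = s.
Proof.
have := conv_antr (truss_sigma_comor T); rewrite -/s -/l -/m -/ls -/u => E.
have E2 := gam_unit0; rewrite gam_unit in E2.
rewrite -[s in RHS](@convU _ H H unitO) // -/m -/u -/e E2 convA0 //.
by rewrite E conv1.
Qed.

Lemma m2_unit : cmp m2 (tns (ida H) u) = s.
Proof. by rewrite -tauE tau_sigma. Qed.

Lemma sigma_gam : cmp m (box H unitO H s g) = m2.
Proof.
have := conv_antr (truss_sigma_comor T); rewrite -/s -/l -/m -/ls -/u => E.
by rewrite gamE convA0 // E conv1.
Qed.

Notation HH := (tens_comonoid H H).
Let F1 : arrow C := cmp g (tns (ida H) ls).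
Let P : arrow C := tns ls e.
Let W : arrow C := cmp m2 (tns (ida H) m2).
Let a : arrow C := cmp s m2.

Lemma aE : a = cmp m2 (tns (ida H) s).
Proof.
rewrite -m2_unit tns_cmpr // -cmpA // m2A /a -{1}m2_unit !cmpA //; congr cmp.
have := tns_exr m2 u; rewrite /= tnsU => <-.
by rewrite (tns_exl m2 u) -tnsI tnsA.
Qed.

Lemma F1P : cmp m (box HH unitO unitO F1 P) = cmp l a.
Proof.
have sF1 : src F1 = H ⊗ H by [].
have tF1 : tgt F1 = H by rewrite /F1.
have sP : src P = H ⊗ H by [].
have tP : tgt P = H by rewrite /P; ty.
pose aT : Hom HH H := truss_sigma T ∘ truss_mul2 T.
have aTE : Arrow aT = a by rewrite compE.
have aco : is_comonoid_mor aT.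
  have [c1 c2] := truss_sigma_comor T; have [b1 b2] := truss_mul2_comor T.
  split; first by rewrite /aT compA c1 b1.
  by rewrite /aT compA c2 -compA b2 compA -tensm_comp.
have Es := conv_antr (truss_sigma_comor T); rewrite -/s -/l -/m -/ls -/u in Es.
have Ea := conv_antl aco; rewrite aTE -/l -/m -/u in Ea.
have sa : src a = H ⊗ H by rewrite -aTE.
have ta : tgt a = H by rewrite -aTE.
have E1 : cmp m (box HH unitO unitO a F1) = tns s e.
  rewrite box_tens // tenso1 tnsU aE /F1.
  rewrite -(@box_pre _ H H H m2 g s ls) // tgt_ls cmpA // -tns_cmpr //.
  rewrite -[LHS]cmpA // -distrE cmpA // -tns_cmpr //.
  rewrite -box0 Es tns_cmpr // -cmpA // m2_unit.
  by rewrite (tns_exl s e) tnsU.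
have E2 : cmp m (box HH unitO unitO (tns s e) P) = cmp u (eps HH).
  rewrite box_tens // tenso1 tnsU /P.
  rewrite (tns_exl s e) (tns_exl ls e) src_ls /= !tnsU.
  rewrite -(@box_pre _ H H H s ls e e) // cmpA // -tns_cmpr //.
  have -> : cmp (tns e e) (dlt H) = e.
    by rewrite (tns_exr e e) cmpA // dlt1 tns1 cmpI.
  by rewrite -[LHS]cmpA // Es cmpA // /eps /= tens_counitE (tns_exl (eps H)) tnsU.
have sX : src (cmp m (box HH unitO unitO F1 P)) = H ⊗ H by ty.
have tX : tgt (cmp m (box HH unitO unitO F1 P)) = H by ty.
have E3 : cmp m (box HH unitO unitO a (cmp m (box HH unitO unitO F1 P))) =
    cmp u (eps HH).
  by rewrite convA0 // -/m E1 E2.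
rewrite -[RHS](@convU _ H HH unitO) // -/m -/u -E3.
by rewrite convA0 // -/m Ea conv1.
Qed.

Lemma gam_module : cmp g (tns (ida H) g) = cmp g (tns m2 (ida H)).
Proof.
have sF1 : src F1 = H ⊗ H by [].
have tF1 : tgt F1 = H by rewrite /F1.
have sP : src P = H ⊗ H by [].
have tP : tgt P = H by rewrite /P; ty.
have sW : src W = H ⊗ H ⊗ H by [].
have tW : tgt W = H by rewrite /W.
have L1 : cmp g (tns (ida H) g) =
    cmp m (box HH unitO H F1 (cmp g (tns (ida H) m2))).
  rewrite box_tens // /F1 -(@box_pre _ H H (H ⊗ H) g g ls m2) // tgt_ls.
  rewrite [cmp (cmp (box _ _ _ _ _) _) _]cmpA // -tns_cmpr //.
  rewrite -[RHS]cmpA // -gam_mul cmpA // -tns_cmpr //.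
  by rewrite {2}gamE /box spread1.
have L2 : cmp g (tns (ida H) m2) = cmp m (box HH unitO H P W).
  rewrite {1}gamE box_tens // cmpA //; congr cmp.
  have := @box_pre _ H unitO (H ⊗ H) ls m2 (ida unitO) m2.
  rewrite tns1 tnsU cmpI // => -> //.
  have := @box_pre _ H H (H ⊗ H) ls W e (ida (H ⊗ H)).
  rewrite tnsI cmpI // => E.
  have -> : P = cmp ls (tns (ida H) e) by rewrite /P (tns_exl ls e) src_ls tnsU.
  rewrite -E // [RHS]cmpA // -tns_cmpr // -tnsI -tnsA -tns_cmpl //.
  by rewrite dlt1 !tnsI cmpI.
have L3 : cmp g (tns m2 (ida H)) = cmp m (box HH unitO H (cmp l a) W).
  rewrite gamE /box !spread1 cmpA // cmpA // -tns_cmpl // -/d m2_comul.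
  rewrite tns_cmpl // -[in LHS](cmpA (h := tns ls m2)) // tnsA.
  by rewrite -tns_cmp // -m2A /W /ls /a cmpA.
by rewrite L1 L2 convA0 // -/m F1P L3.
Qed.

Lemma gamma_module_monoid :
  is_nu_module_monoid (B := truss2 T) (A := bim_mon H) Gam.
Proof.
split.
- by rewrite /is_nu_module !(compE Gam) !tensE; exact: gam_module.
- rewrite (compE Gam) !tensE; apply: etrans gam_unit _.
  by rewrite (tns_exr (Arrow (counit _))) /= tns1 tnsU.
- have E (phi : Hom (H ⊗ H) H) :
    Arrow (bim_mul H ∘ (phi ⊠ phi) ⊙ (idm H ⊠ braid H H ⊠ idm H)
           ⊙ (comul H ⊠ idm H ⊠ idm H))
    = cmp m (box H H H (Arrow phi) (Arrow phi)).
    by rewrite !compSE compE !tensE !idmE tnsI /box /spread !cmpA.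
  apply: arrow_inj; rewrite (compE Gam); apply: etrans gam_mul _.
  by rewrite [RHS]E.
Qed.

Lemma sigma_cocycle : idm H ∘ truss_mul2 T
  = bim_mul H ∘ ((idm H ∘ truss_sigma T) ⊠ Gam) ⊙ (comul H ⊠ idm H).
Proof.
have E (phi : Hom (H ⊗ H) H) :
  Arrow (bim_mul H ∘ (truss_sigma T ⊠ phi) ⊙ (comul H ⊠ idm H))
  = cmp m (box H unitO H s (Arrow phi)).
  by rewrite compSE compE !tensE /box spread1 cmpA.
by apply: arrow_inj; rewrite !comp1m [RHS]E sigma_gam.
Qed.

Lemma idm_comor : is_comonoid_mor (idm H).
Proof. by split; rewrite ?tensm_id ?comp1m compm1. Qed.

Lemma idm_iso : is_iso (idm H).
Proof. by exists (idm H); rewrite comp1m. Qed.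

Definition truss_cocycle : gen_inv_cocycle (truss2 T) H :=
  @Cocycle _ (truss2 T) H Gam gamma_module_monoid (idm H) idm_comor idm_iso
    (truss_sigma T) (truss_sigma_comor T) sigma_cocycle.

End TrussCocycle.

Section TrussModules.
Variables (C : strict_braided) (T : hopf_truss C).
Let H : hopf_monoid C := truss1 T.

Record truss_module := TrussModule {
  tm_ob : C;
  tm_act1 : Hom (H ⊗ tm_ob) tm_ob;
  tm_act2 : Hom (H ⊗ tm_ob) tm_ob;
  tm_act1P : is_module (A := bim_mon H) tm_act1;
  tm_act2P : is_nu_module (B := truss2 T) tm_act2;
  tm_compat :
    tm_act2 ∘ (idm H ⊠ tm_act1)
    = tm_act1 ∘ (truss_mul2 T ⊠ gamma (truss_sigma T) tm_act1 tm_act2)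
      ⊙ (idm H ⊠ braid H H ⊠ idm tm_ob)
      ⊙ (comul H ⊠ idm H ⊠ idm tm_ob)
}.

Record truss_module_mor (M M' : truss_module) := TrussModuleMor {
  tmm_hom :> Hom (tm_ob M) (tm_ob M');
  tmm_act1 : tmm_hom ∘ tm_act1 M = tm_act1 M' ∘ (idm H ⊠ tmm_hom);
  tmm_act2 : tmm_hom ∘ tm_act2 M = tm_act2 M' ∘ (idm H ⊠ tmm_hom)
}.

Lemma truss_module_mor_eq (M M' : truss_module) (f g : truss_module_mor M M') :
  tmm_hom f = tmm_hom g -> f = g.
Proof.
case: f g => [f f1 f2] [g g1 g2] /= e; case: g / e g1 g2 => g1 g2.
by rewrite (proof_irrelevance _ f1 g1) (proof_irrelevance _ f2 g2).
Qed.

Lemma linear_id (X M : C) (phi : Hom (X ⊗ M) M) :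
  idm M ∘ phi = phi ∘ (idm X ⊠ idm M).
Proof. by rewrite tensm_id comp1m compm1. Qed.

Lemma linear_comp (X M M' M'' : C) (phi : Hom (X ⊗ M) M)
    (phi' : Hom (X ⊗ M') M') (phi'' : Hom (X ⊗ M'') M'')
    (g : Hom M' M'') (f : Hom M M') :
  g ∘ phi' = phi'' ∘ (idm X ⊠ g) -> f ∘ phi = phi' ∘ (idm X ⊠ f) ->
  (g ∘ f) ∘ phi = phi'' ∘ (idm X ⊠ (g ∘ f)).
Proof.
move=> eg ef; rewrite -[in RHS](comp1m (idm X)) tensm_comp compA -eg.
by rewrite -!compA ef.
Qed.

Definition truss_module_id (M : truss_module) : truss_module_mor M M :=
  TrussModuleMor (linear_id (tm_act1 M)) (linear_id (tm_act2 M)).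

Definition truss_module_comp (M M' M'' : truss_module)
    (g : truss_module_mor M' M'') (f : truss_module_mor M M') :
    truss_module_mor M M'' :=
  TrussModuleMor (linear_comp (tmm_act1 g) (tmm_act1 f))
                 (linear_comp (tmm_act2 g) (tmm_act2 f)).

Program Definition truss_modules : category :=
  {| Ob := truss_module; Hom := truss_module_mor;
     idm := truss_module_id; comp := truss_module_comp |}.
Next Obligation. by apply: truss_module_mor_eq; exact: comp1m. Qed.
Next Obligation. by apply: truss_module_mor_eq; exact: compm1. Qed.
Next Obligation. by apply: truss_module_mor_eq; exact: compA. Qed.

End TrussModules.

Section CocycleModules.
Variables (C : strict_braided) (B : nu_bimonoid C) (H : hopf_monoid C).

Record cocycle_module_data := CocycleModuleData {
  cm_M : C;
  cm_N : C;
  cm_phiM : Hom (B ⊗ cm_M) cm_M;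
  cm_actM : Hom (H ⊗ cm_M) cm_M;
  cm_phiN : Hom (B ⊗ cm_N) cm_N;
  cm_gamma : Hom cm_N cm_M
}.

Variable P : gen_inv_cocycle B H.

Record is_cocycle_module (X : cocycle_module_data) : Prop := IsCocycleModule {
  cm_actMP : is_module (A := bim_mon H) (cm_actM X);
  cm_phiNP : is_nu_module (cm_phiN X);
  cm_phiM_act :
    cm_phiM X ∘ (idm B ⊠ cm_actM X)
    = cm_actM X ∘ (coc_act P ⊠ cm_phiM X)
      ⊙ (idm B ⊠ braid B H ⊠ idm (cm_M X))
      ⊙ (comul B ⊠ idm H ⊠ idm (cm_M X));
  cm_gamma_iso : is_iso (cm_gamma X);
  cm_gamma_phiN :
    cm_gamma X ∘ cm_phiN X
    = cm_actM X ∘ ((coc_map P ∘ coc_theta P) ⊠ cm_phiM X)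
      ⊙ (comul B ⊠ cm_gamma X)
}.

Record cocycle_module := CocycleModule {
  cm_data :> cocycle_module_data;
  cm_dataP : is_cocycle_module cm_data
}.

Record cocycle_module_mor (X Y : cocycle_module) := CocycleModuleMor {
  cmm_h : Hom (cm_M X) (cm_M Y);
  cmm_l : Hom (cm_N X) (cm_N Y);
  cmm_phiM : cmm_h ∘ cm_phiM X = cm_phiM Y ∘ (idm B ⊠ cmm_h);
  cmm_actM : cmm_h ∘ cm_actM X = cm_actM Y ∘ (idm H ⊠ cmm_h);
  cmm_phiN : cmm_l ∘ cm_phiN X = cm_phiN Y ∘ (idm B ⊠ cmm_l);
  cmm_gamma : cmm_h ∘ cm_gamma X = cm_gamma Y ∘ cmm_l
}.

Lemma cocycle_module_mor_eq (X Y : cocycle_module)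
    (f g : cocycle_module_mor X Y) :
  cmm_h f = cmm_h g -> cmm_l f = cmm_l g -> f = g.
Proof.
case: f g => [h l f1 f2 f3 f4] [h' l' g1 g2 g3 g4] /= eh el.
case: h' / eh g1 g2 g4 => g1 g2 g4; case: l' / el g3 g4 => g3 g4.
by rewrite (proof_irrelevance _ f1 g1) (proof_irrelevance _ f2 g2)
  (proof_irrelevance _ f3 g3) (proof_irrelevance _ f4 g4).
Qed.

Lemma gamma_id (X : cocycle_module) :
  idm (cm_M X) ∘ cm_gamma X = cm_gamma X ∘ idm (cm_N X).
Proof. by rewrite comp1m compm1. Qed.

Lemma gamma_comp (X Y Z : cocycle_module)
    (g : cocycle_module_mor Y Z) (f : cocycle_module_mor X Y) :
  (cmm_h g ∘ cmm_h f) ∘ cm_gamma X = cm_gamma Z ∘ (cmm_l g ∘ cmm_l f).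
Proof. by rewrite -compA cmm_gamma !compA cmm_gamma. Qed.

Definition cocycle_module_id (X : cocycle_module) : cocycle_module_mor X X :=
  CocycleModuleMor (linear_id (cm_phiM X)) (linear_id (cm_actM X))
    (linear_id (cm_phiN X)) (gamma_id X).

Definition cocycle_module_comp (X Y Z : cocycle_module)
    (g : cocycle_module_mor Y Z) (f : cocycle_module_mor X Y) :
    cocycle_module_mor X Z :=
  CocycleModuleMor (linear_comp (cmm_phiM g) (cmm_phiM f))
    (linear_comp (cmm_actM g) (cmm_actM f))
    (linear_comp (cmm_phiN g) (cmm_phiN f)) (gamma_comp g f).

Program Definition cocycle_modules : category :=
  {| Ob := cocycle_module; Hom := cocycle_module_mor;
     idm := cocycle_module_id; comp := cocycle_module_comp |}.
Next Obligation. by apply: cocycle_module_mor_eq; exact: comp1m. Qed.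
Next Obligation. by apply: cocycle_module_mor_eq; exact: compm1. Qed.
Next Obligation. by apply: cocycle_module_mor_eq; exact: compA. Qed.

End CocycleModules.

Arguments CocycleModuleData {C B H} cm_M cm_N cm_phiM cm_actM cm_phiN cm_gamma.

(* Main.v *)
(** A compatible pair of actions [psi1], [psi2] satisfies
    [psi2 ∘ (H ⊗ psi1) = psi1 ∘ (mu2 * Γ_M)], where [*] distributes the first
    variable by the coproduct.  Since [Γ_M = psi1 ∘ ((lambda ∘ sigma) * psi2)],
    the [H_1]-module axiom, which says that convolution acts associatively,
    turns this into the product rule for [Γ_M].  Convolving with [sigma], the
    convolution inverse of [lambda ∘ sigma], recovers [psi2] from [Γ_M], which
    is the condition on the isomorphism [id_M]. *)
From Corelib Require Import ssreflect ssrfun ssrbool.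
Require Import Defs.

Set Implicit Arguments.
Unset Strict Implicit.
Unset Printing Implicit Defensive.

#[local] Hint Extern 0 (tgt _ = _) => ty : core.
#[local] Hint Extern 0 (src _ = _) => ty : core.
#[local] Hint Resolve src_spread tgt_spread src_box : core.

Section ActionConvolution.
Variables (C : strict_braided) (H : hopf_monoid C) (D : comonoid C) (M : C).
Variable psi : Hom (H ⊗ M) M.
Hypothesis psiP : is_module (A := bim_mon H) psi.
Implicit Types (Y : C) (F G h : arrow C).

Let m : arrow C := Arrow (bim_mul H).
Let u : arrow C := Arrow (bim_unit H).
Let p : arrow C := Arrow psi.

Lemma actA : cmp p (tns (ida H) p) = cmp p (tns m (ida M)).
Proof. by have := modA psiP; rewrite !compE !tensE !idmE. Qed.

Lemma act1 : cmp p (tns u (ida M)) = ida M.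
Proof. by have := mod1 psiP; rewrite !compE !tensE !idmE. Qed.

(** Coassociativity in [D], in the form [boxA], regroups the three factors; [actA] then trades two
    successive actions for one product. With [M] replaced by [H] this is [convA]. *)
Lemma act_convA Y Y' Y'' F G h :
  src F = D ⊗ Y -> src G = D ⊗ Y' -> src h = D ⊗ Y'' ->
  tgt F = H -> tgt G = H -> tgt h = M ->
  cmp p (box D Y (Y' ⊗ Y'') F (cmp p (box D Y' Y'' G h))) =
  cmp p (box D (Y ⊗ Y') Y'' (cmp m (box D Y Y' F G)) h).
Proof.
move=> sF sG sh tF tG th.
have tb1 := tgt_box sF sG; have tb2 := tgt_box sG sh.
have -> : box D Y (Y' ⊗ Y'') F (cmp p (box D Y' Y'' G h)) =
    cmp (tns (ida H) p) (box D Y (Y' ⊗ Y'') F (box D Y' Y'' G h)).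
  by rewrite box_post // cmp1.
have -> : box D (Y ⊗ Y') Y'' (cmp m (box D Y Y' F G)) h =
    cmp (tns m (ida M)) (box D (Y ⊗ Y') Y'' (box D Y Y' F G) h).
  by rewrite box_post // cmp1.
by rewrite -boxA // -[LHS]cmpA // -[RHS]cmpA // actA.
Qed.

Lemma act_conv1 Y G : src G = D ⊗ Y -> tgt G = M ->
  cmp p (box D unitO Y (cmp u (eps D)) G) = G.
Proof.
move=> sG tG.
have -> : box D unitO Y (cmp u (eps D)) G =
    cmp (tns u (ida M)) (box D unitO Y (eps D) G).
  by rewrite box_post // cmp1.
by rewrite box_eps // -cmpA // act1 cmp1.
Qed.

End ActionConvolution.

Section GammaAction.
Variables (C : strict_braided) (H : hopf_monoid C) (sigma : Hom H H).

(** The first factor depends on the comonoid variable alone, hence the parameter object [unitO]. For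
    [psi1] the product of [H], this covers the action on $H_1$ as well. *)
Lemma gammaE (M : C) (psi1 psi2 : Hom (H ⊗ M) M) :
  Arrow (gamma sigma psi1 psi2) =
  cmp (Arrow psi1)
    (box H unitO M (cmp (Arrow (antipode H)) (Arrow sigma)) (Arrow psi2)).
Proof. by rewrite /gamma compSE !compE !tensE compE /box spread1 cmpA. Qed.

(** The map [f] slides through [psi1], acts only on the second factor of the box, and then slides
    through [psi2]. This supplies the condition on [phi_M] for the pair [(f, f)]. *)
Lemma gamma_natural (M M' : C) (psi1 psi2 : Hom (H ⊗ M) M)
    (psi1' psi2' : Hom (H ⊗ M') M') (f : Hom M M') :
  f ∘ psi1 = psi1' ∘ (idm H ⊠ f) -> f ∘ psi2 = psi2' ∘ (idm H ⊠ f) ->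
  f ∘ gamma sigma psi1 psi2 = gamma sigma psi1' psi2' ∘ (idm H ⊠ f).
Proof.
move=> /(f_equal (@Arrow _ _ _)) e1 /(f_equal (@Arrow _ _ _)) e2.
rewrite !(compE f) (compE psi1') (compE psi2') !tensE in e1 e2.
apply: arrow_inj; rewrite (compE f) (compE (gamma _ _ _)) !gammaE !tensE.
rewrite -cmpA // e1 [LHS]cmpA // [RHS]cmpA //; congr cmp; rewrite box_post // cmp1 // e2.
(* The first factor carries no module variable, so [f] is precomposed as [ida unitO] tensored with
   [f]. *)
have := @box_pre _ H unitO M (cmp (Arrow (antipode H)) (Arrow sigma))
  (Arrow psi2') (ida unitO) (Arrow f).
by rewrite tns1 tnsU cmpI // => /= ->.
Qed.

End GammaAction.

Section TrussModule.
Variables (C : strict_braided) (T : hopf_truss C) (M : truss_module T).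
Let H : hopf_monoid C := truss1 T.
Let Gam := gamma (truss_sigma T) (tm_act1 M) (tm_act2 M).
Let GamH := gamma (truss_sigma T) (bim_mul H) (truss_mul2 T).

Lemma gamma_act : Gam ∘ (idm H ⊠ tm_act1 M) =
  tm_act1 M ∘ (GamH ⊠ Gam) ⊙ (idm H ⊠ braid H H ⊠ idm (tm_ob M))
    ⊙ (comul H ⊠ idm H ⊠ idm (tm_ob M)).
Proof.
(* Stated for arbitrary [a] and [c] so as to serve both the compatibility axiom, with [a] the second
   product, and the goal, with [a] equal to [GamH]. *)
have boxE (a : Hom (H ⊗ H) H) (c : Hom (H ⊗ tm_ob M) (tm_ob M)) :
  Arrow (tm_act1 M ∘ (a ⊠ c) ⊙ (idm H ⊠ braid H H ⊠ idm (tm_ob M))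
    ⊙ (comul H ⊠ idm H ⊠ idm (tm_ob M))) =
  cmp (Arrow (tm_act1 M)) (box H H (tm_ob M) (Arrow a) (Arrow c)).
  by rewrite !compSE compE !tensE !idmE tnsI /box /spread !cmpA.
have compat := f_equal (@Arrow _ _ _) (tm_compat M).
rewrite boxE // compE tensE idmE in compat.
apply: arrow_inj; rewrite boxE // compE tensE idmE {1}/Gam gammaE cmpA //.
set p := Arrow (tm_act1 M); set ls := cmp (Arrow (antipode _)) _.
have sls : src ls = H by [].
have tls : tgt ls = H by [].
(* Moves the inner action next to [tm_act2 M], where the compatibility axiom applies. *)
have := @box_pre _ H unitO (H ⊗ tm_ob M) ls (Arrow (tm_act2 M)) (ida unitO) p.
rewrite tns1 tnsU [cmp ls _]cmpI // => -> //.
(* Reassociating joins [ls] to the second product, and their convolution is [GamH] by [gammaE]. *)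
rewrite compat (act_convA (tm_act1P M)) // tens1o.
by rewrite /ls -!gammaE.
Qed.

Lemma sigma_gamma : tm_act2 M =
  tm_act1 M ∘ (truss_sigma T ⊠ Gam) ⊙ (comul H ⊠ idm (tm_ob M)).
Proof.
apply: arrow_inj; rewrite compSE compE !tensE idmE cmpA //.
rewrite -[X in cmp _ (cmp _ X)]spread1 -/(box _ _ _ _ _) /Gam gammaE.
have inv := conv_antr (truss_sigma_comor T).
have := act_convA (tm_act1P M) (D := H) (Y := unitO) (Y' := unitO)
  (Y'' := tm_ob M) (F := Arrow (truss_sigma T))
  (G := cmp (Arrow (antipode H)) (Arrow (truss_sigma T)))
  (h := Arrow (tm_act2 M)).
(* With both parameter objects equal to [unitO], strictness removes them from the sources, leaving
   [sigma] convolved with its inverse. *)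
rewrite !tens1o !tenso1 => -> //.
by rewrite inv (act_conv1 (tm_act1P M)).
Qed.

Lemma truss_cocycle_module : is_cocycle_module (truss_cocycle T)
  (CocycleModuleData (B := truss2 T) (H := H) (tm_ob M) (tm_ob M)
     Gam (tm_act1 M) (tm_act2 M) (idm (tm_ob M))).
Proof.
split=> /=.
- exact: tm_act1P.
- exact: tm_act2P.
- exact: gamma_act.
- by exists (idm (tm_ob M)); rewrite comp1m.
- by rewrite !comp1m; exact: sigma_gamma.
Qed.

End TrussModule.

Section TrussFunctor.
Variables (C : strict_braided) (T : hopf_truss C).

Definition truss_functor_ob (M : truss_module T) :
  cocycle_module (truss_cocycle T) := CocycleModule (truss_cocycle_module M).

Lemma idm_natural (M M' : C) (f : Hom M M') : f ∘ idm M = idm M' ∘ f.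
Proof. by rewrite comp1m compm1. Qed.

Definition truss_functor_mor (M M' : truss_module T)
    (f : truss_module_mor M M') :
    cocycle_module_mor (truss_functor_ob M) (truss_functor_ob M') :=
  @CocycleModuleMor _ _ _ _ (truss_functor_ob M) (truss_functor_ob M')
    (tmm_hom f) (tmm_hom f)
    (gamma_natural (truss_sigma T) (tmm_act1 f) (tmm_act2 f))
    (tmm_act1 f) (tmm_act2 f) (idm_natural (tmm_hom f)).

Program Definition truss_functor :
  functor (truss_modules T) (cocycle_modules (truss_cocycle T)) :=
  @Functor (truss_modules T) (cocycle_modules (truss_cocycle T))
    truss_functor_ob truss_functor_mor _ _.
Next Obligation. exact: cocycle_module_mor_eq. Qed.
Next Obligation. exact: cocycle_module_mor_eq. Qed.

End TrussFunctor.

Theorem theorem4p12 (C : strict_braided) (H : hopf_truss C) :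
  exists G : functor (truss_modules H) (cocycle_modules (truss_cocycle H)),
    (forall M : truss_module H,
       cm_data (G M) =
       CocycleModuleData (B := truss2 H) (H := truss1 H)
         (tm_ob M) (tm_ob M)
         (gamma (truss_sigma H) (tm_act1 M) (tm_act2 M))
         (tm_act1 M)
         (tm_act2 M)
         (idm (tm_ob M)))
    /\
    (forall (M M' : truss_module H) (f : truss_module_mor M M'),
       cmm_h (fmap G (A := M) (B := M') f) ≡ tmm_hom f /\
       cmm_l (fmap G (A := M) (B := M') f) ≡ tmm_hom f).
Proof. by exists (truss_functor H). Qed.
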